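(* For every $n\ge1$, the set $\mathrm{TSSCPP}(n)$ of totally symmetric self-complementary plane partitions in a $2n\times 2n\times 2n$ box (equivalently, the set of TSSCPP boolean triangles of order $n$) is in weight-preserving bijection with the set of pseudo-Yamanouchi pipe dreams of size $n$ (reduced or not).
   Context: Elements of $\mathrm{TSSCPP}(n)$ are identified, via a standard bijection, with TSSCPP boolean triangles of order $n$: arrays $b=(b_{i,j})$, $1\le i\le n-1$, $n-i\le j\le n-1$, entries in $\{0,1\}$, with $1+\sum_{k=j+1}^{i} b_{k,n-j-1}\ge \sum_{k=j}^{i} b_{k,n-j}$ for all $1\le j<i\le n-1$. Weight: $\mathrm{wt}(b)=\prod_{(i,j):\,b_{i,j}=1}x_{n-i}$. A pipe dream of size $n$ is a tiling of the $n\times n$ grid (rows $1..n$ top to bottom, columns $1..n$ left to right) by cross tiles and elbow tiles, with every position $(i,j)$, $i+j\ge n+1$, an elbow tile; no reducedness is required. Its weight is $\prod x_r$ over cross tiles at $(r,c)$. Reading word: scan rows from bottom to top, within each row left to right; each cross at $(r,c)$ appends $r+c-1$ to a word $\mathbf a=(a_1,\dots,a_\ell)$. Let $\mathrm{cnt}(k,j)$ be the number of occurrences of $j$ among $a_1,\dots,a_k$. The pipe dream is pseudo-Yamanouchi if $1+\mathrm{cnt}(k,j)\ge\mathrm{cnt}(k,j+1)$ for all $1\le k\le \ell$, $1\le j\le n-2$. *)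

(* Defs.v *)
From HB Require Import structures.
From mathcomp Require Import all_boot all_order all_algebra.
From mathcomp Require Import mpoly.

Set Implicit Arguments.
Unset Strict Implicit.
Unset Printing Implicit Defensive.

Import GRing.Theory.
Local Open Scope ring_scope.

(** A plane partition in a (2n) x (2n) x (2n) box is given by its set of unit
    boxes, with 0-based coordinates (the box (x, y, z) is in the diagram iff the
    (x+1, y+1) entry of the plane partition is at least z+1). *)
Definition box (n : nat) : finType := ('I_n.*2 * 'I_n.*2 * 'I_n.*2)%type.

Definition plane_partition (n : nat) (T : {set box n}) : bool :=
  [forall p : box n, forall q : box n,
     [&& p \in T, (q.1.1 <= p.1.1)%N, (q.1.2 <= p.1.2)%N & (q.2 <= p.2)%N]
     ==> (q \in T)].

(** The two transpositions generate all the permutations of the axes. *)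
Definition totally_symmetric (n : nat) (T : {set box n}) : bool :=
  [forall x, forall y, forall z,
     (((x, y, z) \in T) == ((y, x, z) \in T)) &&
     (((x, y, z) \in T) == ((x, z, y) \in T))].

Definition self_complementary (n : nat) (T : {set box n}) : bool :=
  [forall x, forall y, forall z,
     ((x, y, z) \in T) == ((rev_ord x, rev_ord y, rev_ord z) \notin T)].

Definition is_TSSCPP (n : nat) (T : {set box n}) : bool :=
  [&& plane_partition T, totally_symmetric T & self_complementary T].

Definition TSSCPP (n : nat) : Type := {T : {set box n} | is_TSSCPP T}.

(** Triangles and pipe dreams are indexed from 1, as elements of 'I_n.+1; the
    entries outside of the triangle or of the grid (in particular those with
    index 0) are padding, required to be [false]. *)
Definition is_boolean_triangle (n : nat) (b : 'M[bool]_n.+1) : bool :=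
  [forall i : 'I_n.+1, forall j : 'I_n.+1,
     b i j ==> (1 <= i <= n - 1)%N && (n - i <= j <= n - 1)%N] &&
  [forall i : 'I_n.+1, forall j : 'I_n.+1,
     (1 <= j)%N && (j < i <= n - 1)%N ==>
     (\sum_(j <= k < i.+1) b (inord k) (inord (n - j))
      <= 1 + \sum_(j.+1 <= k < i.+1) b (inord k) (inord (n - j - 1)))%N].

Definition boolean_triangle (n : nat) : Type :=
  {b : 'M[bool]_n.+1 | is_boolean_triangle b}.

(** The variables are x_0, ..., x_n; only x_1, ..., x_(n-1) occur in weights. *)
Definition xvar (n r : nat) : {mpoly int[n.+1]} := 'X_(inord r).

Definition triangle_weight (n : nat) (b : 'M[bool]_n.+1) : {mpoly int[n.+1]} :=
  \prod_(i < n.+1) \prod_(j < n.+1 | b i j) xvar n (n - i).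

(** The standard triangle of a TSSCPP, from its family of nonintersecting
    lattice paths.  In the fundamental domain x, y >= n, x <= y, the boxes at
    height n - j (that is, with 0-based coordinate z = n - j - 1) form a shifted
    Young diagram whose row lengths are distinct and at most j.  Its boundary is
    a path with j steps: the step at distance s from the main diagonal (s = j,
    ..., 1) is a diagonal step (entry 0) if s is the length of a row, and a
    vertical step (entry 1) otherwise.  The entry (i, j) records the step at
    distance s = n - i of the path at height n - j. *)
Definition triangle_of (n : nat) (T : {set box n}) : 'M[bool]_n.+1 :=
  \matrix_(i < n.+1, j < n.+1)
    [&& (1 <= i <= n - 1)%N, (n - i <= j <= n - 1)%N &
      ~~ [exists x : 'I_n.*2, exists z : 'I_n.*2,
            [&& (n <= x)%N, (z + j + 1 == n)%N &
                (#|[set y : 'I_n.*2 | (x <= y)%N & (x, y, z) \in T]|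
                 == n - i)%N]]].

(** [D r c] is [true] for a cross tile at (r, c), and [false] for an elbow tile. *)
Definition is_pipe_dream (n : nat) (D : 'M[bool]_n.+1) : bool :=
  [forall r : 'I_n.+1, forall c : 'I_n.+1,
     D r c ==> [&& (1 <= r)%N, (1 <= c)%N & (r + c < n + 1)%N]].

Definition reading_word (n : nat) (D : 'M[bool]_n.+1) : seq nat :=
  flatten [seq [seq (r + c - 1)%N | c <- iota 1 n & D (inord r) (inord c)]
             | r <- rev (iota 1 n)].

Definition cnt (a : seq nat) (k j : nat) : nat := count_mem j (take k a).

Definition pseudo_Yamanouchi (n : nat) (D : 'M[bool]_n.+1) : bool :=
  let a := reading_word D in
  all (fun k => all (fun j => (cnt a k j.+1 <= 1 + cnt a k j)%N)
                    (iota 1 (n - 2)))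
      (iota 1 (size a)).

Definition PY_pipe_dream (n : nat) : Type :=
  {D : 'M[bool]_n.+1 | is_pipe_dream D && pseudo_Yamanouchi D}.

Definition pipe_dream_weight (n : nat) (D : 'M[bool]_n.+1) :
    {mpoly int[n.+1]} :=
  \prod_(r < n.+1) \prod_(c < n.+1 | D r c) xvar n r.

(* Main.v *)
(** A TSSCPP [T] is determined by its boxes [(n + a, n + e, n - 1 - d)], that is,
    by a chain of shifted diagrams indexed by [d < n].  Self-complementarity
    amounts to the row lengths of diagram [d] being at most [d], so diagram [d]
    is an arbitrary set [S_d] of distinct row lengths in [{1, ..., d}].  With
    [C_d(t) = #{s in S_d | s >= t}], the cell [(a, e)] with [a <= e] lies in
    diagram [d] iff [a < C_d(e - a + 1)], and diagrams are nested iff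
    [C_d(t) <= C_{d+1}(t)] for all [t].  Since the zero entries of column [d] of
    the triangle encode [S_d], these are the defining inequalities of boolean
    triangles.

    Moving the entry [(i, j)] of the triangle to the tile in row [n - i] with
    letter [j] turns those inequalities into the pseudo-Yamanouchi condition for
    the prefixes of the reading word that end at the end of a row.  These
    prefixes suffice, because a row reads its letters in increasing order. *)

Require Import Defs.
From HB Require Import structures.
From mathcomp Require Import all_boot all_order all_algebra.
From mathcomp Require Import mpoly.
From mathcomp Require Import zify.

Set Implicit Arguments.
Unset Strict Implicit.
Unset Printing Implicit Defensive.

Import GRing.Theory.
Local Open Scope ring_scope.
Local Open Scope nat_scope.

(** * Sums of indicators and finite bijections *)

Lemma sum_nat_ltn (L N : nat) : L <= N -> \sum_(i < N) (i < L) = L.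
Proof.
move=> LN; rewrite -(big_mkord predT (fun i => nat_of_bool (i < L))).
rewrite (big_cat_nat (leq0n L) LN) //= big_nat_cond (eq_bigr (fun=> 1)); last first.
  by move=> i; case/andP=> /andP[_ ->].
rewrite -big_nat_cond sum_nat_const_nat subn0 muln1.
rewrite big_nat_cond big1 ?addn0 // => i.
by case/andP=> /andP[Li _] _; rewrite ltnNge Li.
Qed.

(** A bounded, downward closed [f] is the indicator of an initial segment, whose length is the
    sum. *)
Lemma ltn_prefix_sum (N : nat) (f : pred nat) (k : nat) :
  (forall i j, i <= j -> f j -> f i) -> (forall i, f i -> i < N) ->
  (k < \sum_(i < N) f i) = f k.
Proof.
move=> fdown fN.
have ex : exists i, ~~ f i by exists N; apply/negP=> /fN; rewrite ltnn.
case: (ex_minnP ex) => L fL Lmin.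
have fE i : f i = (i < L).
  apply/idP/idP=> [fi|iL]; first by rewrite ltnNge; apply: contra fL => /fdown->.
  by apply: contraTT iL => /Lmin; rewrite -leqNgt.
have LN : L <= N by apply: Lmin; apply/negP=> /fN; rewrite ltnn.
rewrite fE; under eq_bigr do rewrite fE.
by rewrite sum_nat_ltn.
Qed.

Lemma sum_nat_subn (F : nat -> nat) (n j i : nat) : j <= i <= n ->
  \sum_(j <= k < i.+1) F (n - k) = \sum_(n - i <= r < (n - j).+1) F r.
Proof.
case/andP; elim: i => [|i IH].
  by rewrite leqn0 => /eqP-> _; rewrite !big_nat1 subn0.
rewrite leq_eqVlt => /orP[/eqP-> _|ji ilen]; first by rewrite !big_nat1.
rewrite big_nat_recr /=; last by lia.
rewrite IH; [|lia|lia].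
rewrite [RHS]big_ltn; last by lia.
by rewrite addnC subnSK.
Qed.

Lemma surj_inj_bij (A B : finType) (f : A -> B) :
  injective f -> (forall y, exists x, f x = y) -> bijective f.
Proof.
move=> finj fsurj; apply: inj_card_bij => //.
have [g gK] := fin_all_exists fsurj.
by apply: (@leq_card _ _ g); apply: can_inj gK.
Qed.

(** * Ballot sequences and tail counts *)

(* [f r v] means that row [r] contains the letter [v]. *)
Definition ballot (n : nat) (f : nat -> nat -> bool) : Prop :=
  forall v t, 1 <= t <= v -> v.+1 < n ->
    \sum_(t <= r < n.+1) f r v.+1 <= 1 + \sum_(t <= r < n.+1) f r v.

Lemma sum_support (n : nat) (f : nat -> nat -> bool) (v t : nat) :
  (forall r v, f r v -> r <= v) -> v <= n ->
  \sum_(t <= r < n.+1) f r v = \sum_(t <= r < v.+1) f r v.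
Proof.
move=> fs vn; case: (leqP t v.+1) => tv.
  rewrite (big_cat_nat tv) /=; last by lia.
  rewrite [X in _ + X]big_nat_cond [X in _ + X]big1 ?addn0 // => r.
  case/andP=> /andP[vr _] _; case E: (f r v) => //.
  by move/fs: E; lia.
rewrite [RHS]big_geq; last by lia.
rewrite big_nat_cond big1 // => r.
case/andP=> /andP[vr _] _; case E: (f r v) => //.
by move/fs: E; lia.
Qed.

(** For [t = v.+1] the left side has at most one nonzero term, and beyond that it is empty. *)
Lemma ballot_all (n : nat) (f : nat -> nat -> bool) (v t : nat) :
  (forall r v, f r v -> r <= v) -> ballot n f -> 1 <= v -> v.+1 < n -> 1 <= t ->
  \sum_(t <= r < n.+1) f r v.+1 <= 1 + \sum_(t <= r < n.+1) f r v.
Proof.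
move=> fs bf v1 vn t1; case: (leqP t v) => tv; first by apply: bf; lia.
rewrite sum_support //; last by lia.
case: (ltngtP t v.+1) => [|tv'|->]; [lia|by rewrite big_geq|].
by rewrite big_nat1; case: (f _ _).
Qed.

(** The set [S_d] of row lengths [s], encoded by the places of column [d] without a cross. *)
Definition compl_cross (n : nat) (f : nat -> nat -> bool) (d s : nat) : bool :=
  [&& 1 <= s, s <= d, d < n & ~~ f s d].

Definition tail_count (n : nat) (S : nat -> nat -> bool) (d t : nat) : nat :=
  \sum_(t <= s < n.+1) S d s.

(** Each place [r] with [t <= r <= d] is counted by exactly one of the two sums. *)
Lemma tail_count_compl (n : nat) (f : nat -> nat -> bool) (d t : nat) :
  (forall r v, f r v -> r <= v) -> 1 <= t -> d < n ->
  tail_count n (compl_cross n f) d t + \sum_(t <= r < n.+1) f r d = d.+1 - t.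
Proof.
move=> fs t1 dn; rewrite sum_support //; last by lia.
rewrite /tail_count (@sum_support n (fun s d => compl_cross n f d s)); last 2 first.
- by move=> r v /and4P[].
- by lia.
rewrite -big_split /= -[RHS]muln1 -sum_nat_const_nat.
apply: eq_big_nat => r /andP[tr rd].
by rewrite /compl_cross (leq_trans t1 tr) -ltnS rd dn /=; case: (f r d).
Qed.

(** Going from [d] to [d.+1] adds one place to count; this is the slack [1] of the ballot
    inequality. *)
Lemma ballot_tail (n : nat) (f : nat -> nat -> bool) :
  (forall r v, f r v -> r <= v) ->
  ballot n f <-> forall d d' t, 1 <= t -> d <= d' -> d' < n ->
    tail_count n (compl_cross n f) d t <= tail_count n (compl_cross n f) d' t.
Proof.
move=> fs; split=> [bf d d' t t1|H v t /andP[t1 tv] vn]; last first.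
  have := H v v.+1 t t1 (leqnSn v) vn.
  have := tail_count_compl fs t1 vn.
  have := tail_count_compl fs t1 (ltnW vn).
  lia.
elim: d' => [|d' IH]; first by rewrite leqn0 => /eqP->.
rewrite leq_eqVlt => /orP[/eqP->//|dd'] dn.
apply: leq_trans (IH dd' (ltnW dn)) _.
have E1 := tail_count_compl fs t1 dn.
have E2 := tail_count_compl fs t1 (ltnW dn).
(* The ballot inequality starts at letter 1; for [d' = 0] there is no place to count, so the tail
   count is 0. *)
case: (posnP d') => [d0|d0].
  by move: E2; rewrite d0; lia.
have := ballot_all fs bf d0 dn t1.
case: (leqP t d') => td; first by lia.
move: E1 E2; lia.
Qed.

Lemma tail_count_step (n : nat) (S : nat -> nat -> bool) (d t : nat) :
  t <= n -> tail_count n S d t = S d t + tail_count n S d t.+1.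
Proof. by move=> tn; rewrite /tail_count big_ltn. Qed.

Lemma tail_count_big (n : nat) (S : nat -> nat -> bool) (d t : nat) :
  n < t -> tail_count n S d t = 0.
Proof. by move=> tn; rewrite /tail_count big_geq. Qed.

Lemma tail_count_lipschitz (n : nat) (S : nat -> nat -> bool) (d t k : nat) :
  tail_count n S d (t + k) <= tail_count n S d t <= tail_count n S d (t + k) + k.
Proof.
elim: k => [|k]; first by rewrite !addn0 leqnn.
rewrite addnS => IH; case: (leqP (t + k) n) => tn.
  by move: IH; rewrite (tail_count_step _ _ tn); case: (S d _); lia.
rewrite (tail_count_big _ _ (ltnW tn : n < (t + k).+1)).
by move: IH; rewrite (tail_count_big _ _ tn); lia.
Qed.

Lemma tail_count_ub (n : nat) (f : nat -> nat -> bool) (d t : nat) :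
  1 <= t -> tail_count n (compl_cross n f) d t <= d.+1 - t.
Proof.
move=> t1; rewrite /tail_count -[leqRHS]muln1 -sum_nat_const_nat.
case: (leqP n d) => dn.
  by rewrite big_nat_cond big1 // => s _; rewrite /compl_cross [d < n]ltnNge dn !andbF.
rewrite (@sum_support n (fun s d => compl_cross n f d s)); last 2 first.
- by move=> r v /and4P[].
- by lia.
by apply: leq_sum => s _; case: (compl_cross _ _ _ _).
Qed.

(** * Chains of shifted diagrams *)

(* [P d a e] is the cell [(a, e)] of diagram [d], symmetrized in [a] and [e]. *)
Record staircase (n : nat) (P : nat -> nat -> nat -> bool) : Prop := Staircase {
  stair_mono : forall d d' a a' e e', P d a e ->
    d <= d' -> d' < n -> a' <= a -> e' <= e -> P d' a' e';
  stair_sym : forall d a e, P d a e = P d e a;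
  stair_bound : forall d a e, P d a e -> a < d;
  stair_height : forall d a e, P d a e -> d < n }.

(* Row [a] occupies the columns [a, ..., a + s - 1] when its length is [s]. *)
Definition row_set (n : nat) (P : nat -> nat -> nat -> bool) (d s : nat) : bool :=
  (0 < s) && [exists a : 'I_n, P d a (a + s.-1) && ~~ P d a (a + s)].

(** Row [a] has length at least [t] iff it contains its [t]-th cell [(a, a + t.-1)], and the rows
    with this property come first. *)
Lemma row_count (n : nat) (P : nat -> nat -> nat -> bool) (d t a : nat) :
  staircase n P -> 1 <= t ->
  (a < tail_count n (row_set n P) d t) = P d a (a + t.-1).
Proof.
move=> sP.
have Pe d0 a0 e0 : P d0 a0 e0 -> e0 < d0.
  by rewrite (stair_sym sP); apply: stair_bound sP _ _ _.
(* The number of rows of length at least [t], to be compared with the tail count by descending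
   induction from [n.+1]. *)
pose R t := \sum_(i < n) P d i (i + t.-1).
have RE k i : (i < R k) = P d i (i + k.-1).
  apply: (@ltn_prefix_sum n (fun i => P d i (i + k.-1))) => [i0 j ij Pj|j Pj].
    apply: (stair_mono sP Pj) => //; last by lia.
    exact: (stair_height sP Pj).
  apply: leq_trans (stair_bound sP Pj) _.
  exact: ltnW (stair_height sP Pj).
suff CR k : 1 <= k -> tail_count n (row_set n P) d k = R k.
  by move=> t1; rewrite CR.
move: {2}(n.+1 - k) (erefl (n.+1 - k)) => m; elim: m k => [|m IH] k km k1.
  rewrite tail_count_big; last by lia.
  apply/esym/eqP; rewrite -leqn0 leqNgt RE; apply/negP=> Pk.
  by have := Pe _ _ _ Pk; have := stair_height sP Pk; lia.
rewrite tail_count_step; last by lia.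
rewrite IH; [|lia|lia].
(* [R k] is [R k.+1] or [R k.+1 + 1], the latter iff some row has length [k]. *)
have RR : R k <= (R k.+1).+1.
  case E: (R k) => [|r] //; rewrite ltnS; case: r E => [|r] E //.
  (* The cell [(r.+1, r + k)] forces [(r, r + k)]: a row of length at least [k] lies below a
     strictly longer one, so row lengths are distinct. *)
  have : r.+1 < R k by rewrite E.
  rewrite !RE /= => Pk; apply: (stair_mono sP Pk) => //; last by lia.
  exact: (stair_height sP Pk).
have RS : R k.+1 <= R k.
  case E: (R k.+1) => [|r] //; have : r < R k.+1 by rewrite E.
  rewrite !RE /= => Pk; apply: (stair_mono sP Pk) => //; last by lia.
  exact: (stair_height sP Pk).
have -> : row_set n P d k = (R k.+1 < R k).
  rewrite /row_set k1 /=; apply/existsP/idP=> [[i]|lt].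
    by rewrite -RE -[i + k]/(i + k.+1.-1) -RE; lia.
  have Rn : R k.+1 < n.
    move: (lt); rewrite RE => Pk.
    by have := stair_bound sP Pk; have := stair_height sP Pk; lia.
  exists (Ordinal Rn) => /=.
  by rewrite -RE -[_ + k]/(_ + k.+1.-1) -RE lt ltnn.
by case: ltnP; lia.
Qed.

(** The inverse of [row_set]: the criterion of [row_count] for [a <= e], extended symmetrically by
    [minn] and [maxn]. *)
Definition shape_of (n : nat) (S : nat -> nat -> bool) (d a e : nat) : bool :=
  (d < n) && (minn a e < tail_count n S d (maxn a e - minn a e).+1).

Lemma shape_of_row_set (n : nat) (P : nat -> nat -> nat -> bool) (d a e : nat) :
  staircase n P -> shape_of n (row_set n P) d a e = P d a e.
Proof.
move=> sP; rewrite /shape_of row_count //= subnKC; last by lia.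
have -> : P d (minn a e) (maxn a e) = P d a e.
  by case: (leqP a e) => // _; rewrite (stair_sym sP).
by case E: (P d a e); rewrite ?andbF // (stair_height sP E).
Qed.

(** Growth in [d] is [ballot_tail]. Inside one diagram, the Lipschitz bound on tail counts
    compensates for the change of distance to the diagonal. *)
Lemma shape_of_staircase (n : nat) (f : nat -> nat -> bool) :
  (forall r v, f r v -> r <= v) -> ballot n f ->
  staircase n (shape_of n (compl_cross n f)).
Proof.
move=> fs bf; split.
- move=> d d' a a' e e' /andP[dn H] dd' dn' aa' ee'; rewrite /shape_of dn' /=.
  (* With [t] the distance plus one, [t] plus the minimum is the maximum plus one, so both this sum
     and the minimum decrease; nothing else is used below. *)
  have t'le : (maxn a' e' - minn a' e').+1 + minn a' e'
              <= (maxn a e - minn a e).+1 + minn a e by lia.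
  have mle : minn a' e' <= minn a e by lia.
  move: (maxn a e - minn a e).+1 (maxn a' e' - minn a' e').+1
    (ltn0Sn (maxn a' e' - minn a' e')) H t'le => t t' t'0 H t'le.
  apply: leq_trans ((ballot_tail n fs).1 bf d d' t' t'0 dd' dn').
  case: (leqP t t') => tt'.
    have := tail_count_lipschitz n (compl_cross n f) d t (t' - t).
    by rewrite subnKC //; lia.
  have := tail_count_lipschitz n (compl_cross n f) d t' (t - t').
  by rewrite (subnKC (ltnW tt')); lia.
- by move=> d a e; rewrite /shape_of minnC maxnC.
- move=> d a e /andP[dn H].
  have := @tail_count_ub n f d (maxn a e - minn a e).+1 isT.
  lia.
- by move=> d a e /andP[].
Qed.

(** A row of length [s] exists iff the tail count drops just after [s]; its index is then the number
    of longer rows. *)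
Lemma row_set_shape_of (n : nat) (f : nat -> nat -> bool) (d s : nat) :
  (forall r v, f r v -> r <= v) -> ballot n f ->
  row_set n (shape_of n (compl_cross n f)) d s = compl_cross n f d s.
Proof.
move=> fs bf; set S := compl_cross n f.
have shE a k : shape_of n S d a (a + k) = (d < n) && (a < tail_count n S d k.+1).
  rewrite /shape_of (minn_idPl _) ?leq_addr // (maxn_idPr _) ?leq_addr //.
  by rewrite addKn.
rewrite /row_set; case: s => [|s] //=.
apply/existsP/idP => [[a]|Sds].
  rewrite !shE; case: (ltnP d n) => //= dn /andP[H1 H2].
  have sn : s.+1 <= n.
    by have := @tail_count_ub n f d s.+1 isT; rewrite -/S; lia.
  by move: H1; rewrite tail_count_step //; case: (S d s.+1) => //; lia.
have [_ sd dn _] := and4P Sds.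
have st : tail_count n S d s.+1 = (tail_count n S d s.+2).+1.
  by rewrite tail_count_step ?Sds //; lia.
have an : tail_count n S d s.+2 < n.
  by have := @tail_count_ub n f d s.+1 isT; rewrite -/S; lia.
exists (Ordinal an) => /=.
by rewrite !shE dn /= st ltnSn ltnn.
Qed.

(** * From chains of shifted diagrams to TSSCPPs *)

(* One of the two truncated differences is zero; complementing a coordinate
   preserves its magnitude. *)
Definition magnitude (n x : nat) : nat := (x - n) + (n.-1 - x).

(* The octants with a single coordinate [>= n] are the complements of those with
   two such coordinates. *)
Definition assemble (n : nat) (P : nat -> nat -> nat -> bool) (x y z : nat) : bool :=
  let m := magnitude n in
  if n <= x then
    if n <= y then if n <= z then false else P (m z) (m x) (m y)
    else if n <= z then P (m y) (m x) (m z) else ~~ P (m x) (m y) (m z)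
  else
    if n <= y then if n <= z then P (m x) (m y) (m z) else ~~ P (m y) (m x) (m z)
    else if n <= z then ~~ P (m z) (m x) (m y) else true.

Definition box_of (n : nat) (P : nat -> nat -> nat -> bool) : {set box n} :=
  [set p : box n | assemble n P p.1.1 p.1.2 p.2].

Lemma assembleC12 (n : nat) (P : nat -> nat -> nat -> bool) (x y z : nat) :
  staircase n P -> assemble n P x y z = assemble n P y x z.
Proof.
move=> sP; rewrite /assemble.
by case: (n <= x); case: (n <= y); case: (n <= z); rewrite // 1?(stair_sym sP).
Qed.

Lemma assembleC23 (n : nat) (P : nat -> nat -> nat -> bool) (x y z : nat) :
  staircase n P -> assemble n P x y z = assemble n P x z y.
Proof.
move=> sP; rewrite /assemble.
by case: (n <= x); case: (n <= y); case: (n <= z); rewrite // 1?(stair_sym sP).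
Qed.

(** If [x] and [x'] lie in the same half, this is monotonicity of [P]; crossing the middle exchanges
    [P] for a complement and relies on the bound [a < d]. *)
Lemma assemble_down (n : nat) (P : nat -> nat -> nat -> bool) (x x' y z : nat) :
  staircase n P -> x < n.*2 -> x' <= x -> assemble n P x y z -> assemble n P x' y z.
Proof.
move=> sP xn x'x.
have magh u : n <= u -> magnitude n u = u - n by rewrite /magnitude; lia.
have magl u : u < n -> magnitude n u = n.-1 - u by rewrite /magnitude; lia.
rewrite /assemble; case: (leqP n x') => nx'.
  rewrite (leq_trans nx' x'x) (magh x') // (magh x); last exact: leq_trans x'x.
  case: ifP => _; case: ifP => _ //.
  - by move=> H; apply: (stair_mono sP H); have := stair_height sP H; lia.
  - by move=> H; apply: (stair_mono sP H); have := stair_height sP H; lia.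
  - by apply: contra => H; apply: (stair_mono sP H); have := stair_height sP H; lia.
(* By symmetry and the bound, the two cells give [c < a] and [a < c]. *)
have cross_contra a b c d : P a b c -> P c d a -> False.
  rewrite [P a b c](stair_sym sP).
  by move=> /(stair_bound sP) ca; rewrite (stair_sym sP) => /(stair_bound sP); lia.
case: (leqP n x) => nx.
  by case: ifP => _; case: ifP => _ // H; apply/negP; apply: cross_contra H.
rewrite (magl x') // (magl x) //.
case: ifP => _; case: ifP => _ //.
- by move=> H; apply: (stair_mono sP H); lia.
- by apply: contra => H; apply: (stair_mono sP H); have := stair_height sP H; lia.
- by apply: contra => H; apply: (stair_mono sP H); have := stair_height sP H; lia.
Qed.

Lemma assemble_compl (n : nat) (P : nat -> nat -> nat -> bool) (x y z : nat) :
  x < n.*2 -> y < n.*2 -> z < n.*2 ->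
  assemble n P (n.*2 - x.+1) (n.*2 - y.+1) (n.*2 - z.+1) = ~~ assemble n P x y z.
Proof.
move=> xn yn zn.
have hc u : u < n.*2 -> (n <= n.*2 - u.+1) = (u < n) by lia.
have mc u : u < n.*2 -> magnitude n (n.*2 - u.+1) = magnitude n u.
  by rewrite /magnitude; lia.
rewrite /assemble !hc // !mc //.
by case: (leqP n x); case: (leqP n y); case: (leqP n z); rewrite ?negbK.
Qed.

Lemma box_of_TSSCPP (n : nat) (P : nat -> nat -> nat -> bool) :
  staircase n P -> is_TSSCPP (box_of n P).
Proof.
move=> sP; apply/and3P; split.
- apply/forallP=> -[[x y] z]; apply/forallP=> -[[x' y'] z'] /=.
  apply/implyP; rewrite !inE /= => /and4P[H x'x y'y z'z].
  (* The coordinates are lowered one at a time, each being first moved to the first position. *)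
  have {}H := assemble_down sP (ltn_ord x) x'x H.
  rewrite assembleC12 // in H.
  have {}H := assemble_down sP (ltn_ord y) y'y H.
  rewrite assembleC12 // assembleC23 // assembleC12 // in H.
  have {}H := assemble_down sP (ltn_ord z) z'z H.
  by rewrite assembleC23 // assembleC12 // assembleC23.
- apply/forallP=> x; apply/forallP=> y; apply/forallP=> z.
  by rewrite !inE /= assembleC12 // eqxx /= assembleC12 // assembleC23.
- apply/forallP=> x; apply/forallP=> y; apply/forallP=> z.
  by rewrite !inE /= assemble_compl // negbK.
Qed.

(** * From TSSCPPs to chains of shifted diagrams *)

(** Membership at natural number coordinates, false outside the large box, which avoids carrying
    bounds. *)
Definition mem_box (n : nat) (T : {set box n}) (x y z : nat) : bool :=
  [exists p in T, [&& p.1.1 == x :> nat, p.1.2 == y :> nat & p.2 == z :> nat]].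

Lemma mem_boxE (n : nat) (T : {set box n}) (x y z : 'I_n.*2) :
  mem_box T x y z = ((x, y, z) \in T).
Proof.
apply/existsP/idP=> [[[[x' y'] z']] /= /and4P[]|H]; last first.
  by exists (x, y, z); rewrite H /= !eqxx.
by move=> H /eqP/val_inj<- /eqP/val_inj<- /eqP/val_inj<-.
Qed.

Lemma mem_box_lt (n : nat) (T : {set box n}) (x y z : nat) :
  mem_box T x y z -> [/\ x < n.*2, y < n.*2 & z < n.*2].
Proof.
by case/existsP=> -[[x' y'] z'] /= /and4P[_ /eqP<- /eqP<- /eqP<-].
Qed.

Lemma mem_boxP (n : nat) (T : {set box n}) (x y z : nat) : mem_box T x y z ->
  exists x' y' z' : 'I_n.*2,
    [/\ x' = x :> nat, y' = y :> nat, z' = z :> nat & (x', y', z') \in T].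
Proof.
case/existsP=> -[[x' y'] z'] /= /and4P[H /eqP ? /eqP ? /eqP ?].
by exists x', y', z'.
Qed.

Lemma mem_box_down (n : nat) (T : {set box n}) (x y z x' y' z' : nat) :
  is_TSSCPP T -> mem_box T x y z -> x' <= x -> y' <= y -> z' <= z -> mem_box T x' y' z'.
Proof.
case/and3P=> /forallP pp _ _ H x'x y'y z'z.
have [xn yn zn] := mem_box_lt H.
have /forallP/(_ (Ordinal (leq_ltn_trans x'x xn), Ordinal (leq_ltn_trans y'y yn),
  Ordinal (leq_ltn_trans z'z zn)))/implyP := pp (Ordinal xn, Ordinal yn, Ordinal zn).
rewrite -!mem_boxE /=; apply.
by rewrite H x'x y'y z'z.
Qed.

Lemma mem_box_C12 (n : nat) (T : {set box n}) (x y z : nat) :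
  is_TSSCPP T -> mem_box T x y z = mem_box T y x z.
Proof.
case/and3P=> _ /forallP ts _.
have imp x0 y0 : mem_box T x0 y0 z -> mem_box T y0 x0 z.
  case/mem_boxP=> x' [y' [z' [<- <- <- H]]]; rewrite mem_boxE.
  by have /forallP/(_ y')/forallP/(_ z')/andP[/eqP<-] := ts x'.
by apply/idP/idP; apply: imp.
Qed.

Lemma mem_box_C23 (n : nat) (T : {set box n}) (x y z : nat) :
  is_TSSCPP T -> mem_box T x y z = mem_box T x z y.
Proof.
case/and3P=> _ /forallP ts _.
have imp y0 z0 : mem_box T x y0 z0 -> mem_box T x z0 y0.
  case/mem_boxP=> x' [y' [z' [<- <- <- H]]]; rewrite mem_boxE.
  by have /forallP/(_ y')/forallP/(_ z')/andP[_ /eqP<-] := ts x'.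
by apply/idP/idP; apply: imp.
Qed.

Lemma mem_box_compl (n : nat) (T : {set box n}) (x y z : nat) :
  is_TSSCPP T -> x < n.*2 -> y < n.*2 -> z < n.*2 ->
  mem_box T x y z = ~~ mem_box T (n.*2 - x.+1) (n.*2 - y.+1) (n.*2 - z.+1).
Proof.
case/and3P=> _ _ /forallP sc xn yn zn.
have /forallP/(_ (Ordinal yn))/forallP/(_ (Ordinal zn))/eqP := sc (Ordinal xn).
by rewrite -!mem_boxE.
Qed.

(** The slice at height [n.-1 - d]; the guard is needed since this subtraction truncates to 0 for
    larger [d]. *)
Definition layers (n : nat) (T : {set box n}) (d a e : nat) : bool :=
  (d < n) && mem_box T (n + a) (n + e) (n.-1 - d).

(** The complementary box has all its coordinates below [n], so it would be present as well. *)
Lemma mem_box_high (n : nat) (T : {set box n}) (x y z : nat) :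
  is_TSSCPP T -> n <= x -> n <= y -> n <= z -> ~~ mem_box T x y z.
Proof.
move=> tT xn yn zn; apply/negP=> H; have [xn' yn' zn'] := mem_box_lt H.
move: (H); rewrite mem_box_compl // => /negP; apply.
by apply: (mem_box_down tT H); lia.
Qed.

Lemma layers_staircase (n : nat) (T : {set box n}) :
  is_TSSCPP T -> staircase n (layers T).
Proof.
move=> tT; split.
- move=> d d' a a' e e' /andP[dn H] dd' dn' aa' ee'; rewrite /layers dn' /=.
  by apply: (mem_box_down tT H); lia.
- by move=> d a e; rewrite /layers mem_box_C12.
- move=> d a e /andP[dn H]; rewrite ltnNge; apply/negP=> da.
  (* The complement of this box is [(n.-1 - d, n.-1, n + d)], which after permutation lies below it,
     against self-complementarity. *)
  have H0 : mem_box T (n + d) n (n.-1 - d) by apply: (mem_box_down tT H); lia.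
  move: (H0); rewrite mem_box_compl //; try lia; move/negP; apply.
  have -> : n.*2 - (n.-1 - d).+1 = n + d by lia.
  have -> : n.*2 - (n + d).+1 = n.-1 - d by lia.
  rewrite mem_box_C12 // mem_box_C23 // mem_box_C12 //.
  by apply: (mem_box_down tT H0); lia.
- by move=> d a e /andP[].
Qed.

(** With two or more coordinates at least [n], a permutation reaches a layer or [mem_box_high]
    applies. *)
Lemma mem_box_assemble (n : nat) (T : {set box n}) (x y z : nat) :
  is_TSSCPP T -> x < n.*2 -> y < n.*2 -> z < n.*2 ->
  mem_box T x y z = assemble n (layers T) x y z.
Proof.
move=> tT xn yn zn.
have hhl x0 y0 z0 : n <= x0 -> n <= y0 -> z0 < n ->
    mem_box T x0 y0 z0 = layers T (magnitude n z0) (magnitude n x0) (magnitude n y0).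
  move=> nx ny nz; rewrite /layers /magnitude.
  have -> : z0 - n + (n.-1 - z0) = n.-1 - z0 by lia.
  have -> : n + (x0 - n + (n.-1 - x0)) = x0 by lia.
  have -> : n + (y0 - n + (n.-1 - y0)) = y0 by lia.
  have -> : n.-1 - (n.-1 - z0) = z0 by lia.
  by have -> : n.-1 - z0 < n by lia.
have high x0 y0 z0 : 2 <= (n <= x0) + (n <= y0) + (n <= z0) ->
    mem_box T x0 y0 z0 = assemble n (layers T) x0 y0 z0.
  rewrite /assemble; case: (leqP n x0) => nx; case: (leqP n y0) => ny;
    case: (leqP n z0) => nz //= _.
  - exact/negbTE/mem_box_high.
  - exact: hhl.
  - by rewrite mem_box_C23 // hhl.
  - by rewrite mem_box_C12 // mem_box_C23 // hhl // (stair_sym (layers_staircase tT)).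
case: (leqP 2 ((n <= x) + (n <= y) + (n <= z))) => [/high//|low].
(* Otherwise the complementary box has at least two such coordinates. *)
rewrite mem_box_compl // high ?assemble_compl ?negbK //; lia.
Qed.

Lemma layers_box_of (n : nat) (P : nat -> nat -> nat -> bool) (d a e : nat) :
  staircase n P -> layers (box_of n P) d a e = P d a e.
Proof.
move=> sP; rewrite /layers; case: (ltnP d n) => /= dn; last first.
  by apply/esym/negP=> /(stair_height sP); lia.
have bd a0 e0 : P d a0 e0 -> n + a0 < n.*2.
  by move/(stair_bound sP); lia.
case: (ltnP (n + a) n.*2) => an; last first.
  have -> : P d a e = false by apply/negP=> /bd; lia.
  by apply/negbTE/negP=> /mem_box_lt[]; lia.
case: (ltnP (n + e) n.*2) => en; last first.
  have -> : P d a e = false by rewrite (stair_sym sP); apply/negP=> /bd; lia.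
  by apply/negbTE/negP=> /mem_box_lt[]; lia.
have zn : n.-1 - d < n.*2 by lia.
rewrite (mem_boxE _ (Ordinal an) (Ordinal en) (Ordinal zn)) inE /=.
rewrite /assemble !leq_addr leqNgt.
have -> /= : n.-1 - d < n by lia.
rewrite /magnitude.
have -> : n.-1 - d - n + (n.-1 - (n.-1 - d)) = d by lia.
have -> : n + a - n + (n.-1 - (n + a)) = a by lia.
by have -> : n + e - n + (n.-1 - (n + e)) = e by lia.
Qed.

(** * Row lengths and the entries of the triangle *)

(** The row is an initial segment starting at [x], so its length is read off from its [s]-th cell
    and the next one. *)
Lemma card_row (N x s : nat) (f : pred nat) : 0 < s -> x <= N ->
  (forall i j, x <= i <= j -> f j -> f i) -> (forall i, f i -> i < N) ->
  (#|[set y : 'I_N | (x <= y) && f y]| == s) = f (x + s.-1) && ~~ f (x + s).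
Proof.
move=> s0 xN fdown fN.
have -> : #|[set y : 'I_N | (x <= y) && f y]| = \sum_(k < N) f (x + k).
  rewrite cardsE -sum1_card big_mkcond /=.
  rewrite -(big_mkord predT (fun k => nat_of_bool (f (x + k)))).
  rewrite (eq_bigr (fun y : 'I_N => nat_of_bool ((x <= y) && f y))); last first.
    by move=> y _; rewrite unfold_in; case: (_ && _).
  rewrite -(big_mkord predT (fun y => nat_of_bool ((x <= y) && f y))).
  rewrite (big_cat_nat (leq0n x) xN) /= big_nat_cond big1 ?add0n; last first.
    by move=> i /andP[/andP[_ ix] _]; rewrite leqNgt ix.
  rewrite (big_cat_nat (leq0n (N - x)) (leq_subr x N)) /=.
  rewrite [X in _ = _ + X]big_nat_cond [X in _ = _ + X]big1 ?addn0; last first.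
    move=> i /andP[/andP[Ni _] _]; case E: (f _) => //.
    by have := fN _ E; lia.
  rewrite -{1}(add0n x) big_addn; apply: eq_bigr => i _.
  by rewrite addnC leq_addr.
have pre k := @ltn_prefix_sum N (fun k => f (x + k)) k.
rewrite -!pre; last 4 first.
- by move=> i j ij; apply: fdown; rewrite leq_addr leq_add2l.
- by move=> i /fN; lia.
- by move=> i j ij; apply: fdown; rewrite leq_addr leq_add2l.
- by move=> i /fN; lia.
lia.
Qed.

Lemma triangle_ofE (n : nat) (T : {set box n}) (i j : 'I_n.+1) : is_TSSCPP T ->
  triangle_of T i j =
  [&& 1 <= i <= n - 1, n - i <= j <= n - 1 & ~~ row_set n (layers T) j (n - i)].
Proof.
move=> tT; rewrite mxE.
case: (boolP (1 <= i <= n - 1)) => //= /andP[i1 ilen].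
case: (boolP (n - i <= j <= n - 1)) => //= /andP[ij jn]; congr (~~ _).
have s0 : 0 < n - i by lia.
have key (x z : 'I_n.*2) : n <= x -> z + j + 1 = n ->
    (#|[set y : 'I_n.*2 | (x <= y) & (x, y, z) \in T]| == n - i) =
    layers T j (x - n) (x - n + (n - i).-1) && ~~ layers T j (x - n) (x - n + (n - i)).
  move=> nx zj; have -> : [set y : 'I_n.*2 | (x <= y) & (x, y, z) \in T]
      = [set y : 'I_n.*2 | (x <= y) && mem_box T x y z].
    by apply/setP=> y; rewrite !inE mem_boxE.
  rewrite (@card_row _ _ _ (fun y => mem_box T x y z)) //; last first.
  - by move=> k /mem_box_lt[].
  - by move=> k l /andP[_ kl] H; apply: (mem_box_down tT H).
  - exact: ltnW.
  rewrite /layers.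
  have -> : j < n by lia.
  by congr (mem_box T _ _ _ && ~~ mem_box T _ _ _); lia.
rewrite /row_set s0 /=; apply/existsP/existsP=> [[x]|[a H]].
  case/existsP=> z /and3P[nx /eqP zj]; rewrite key // => H.
  have xn : x - n < n by have := ltn_ord x; lia.
  by exists (Ordinal xn).
have xn : n + a < n.*2 by have := ltn_ord a; lia.
have zn : n - j.+1 < n.*2 by lia.
exists (Ordinal xn); apply/existsP; exists (Ordinal zn).
rewrite key /=; [|lia|lia].
by rewrite leq_addr addKn H andbT /=; lia.
Qed.

(** * Boolean triangles *)

(** The triangle in the coordinates of [ballot]: entry [(n - r, v)] is row [r], letter [v]. *)
Definition cross_at (n : nat) (b : 'M[bool]_n.+1) (r v : nat) : bool :=
  [&& 1 <= r, r <= v, v < n & b (inord (n - r)) (inord v)].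

Lemma cross_at_le (n : nat) (b : 'M[bool]_n.+1) (r v : nat) :
  cross_at b r v -> r <= v.
Proof. by case/and4P. Qed.

Definition triangle_support (n : nat) (b : 'M[bool]_n.+1) : Prop :=
  forall i j : 'I_n.+1, b i j -> (1 <= i <= n - 1) && (n - i <= j <= n - 1).

(** Both sums of the triangle inequality have this shape, the second with [j.+1] for [j]; the
    support allows the upper bound [n.+1]. *)
Lemma triangle_sum (n : nat) (b : 'M[bool]_n.+1) (i j v : nat) :
  triangle_support b -> j <= i -> i <= n - 1 -> 1 <= j -> v < n -> n - j = v ->
  \sum_(j <= k < i.+1) b (inord k) (inord v)
  = \sum_(n - i <= r < n.+1) cross_at b r v.
Proof.
move=> bs ji ilen j1 vn jv.
rewrite sum_support; [|exact: cross_at_le|lia].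
rewrite -jv -(@sum_nat_subn (fun r => nat_of_bool (cross_at b r (n - j)))); last lia.
apply: eq_big_nat => k kji; rewrite /cross_at.
have -> : n - (n - k) = k by lia.
by have [-> -> ->] : [/\ 0 < n - k, n - k <= n - j & n - j < n] by split; lia.
Qed.

Lemma is_boolean_triangleP (n : nat) (b : 'M[bool]_n.+1) :
  is_boolean_triangle b <-> triangle_support b /\ ballot n (cross_at b).
Proof.
split.
  case/andP=> /forallP bs /forallP ineq.
  have sb : triangle_support b.
    by move=> i j; apply/implyP; have /forallP := bs i; apply.
  split=> // v t tv vn.
  (* The ballot inequality at [(v, t)] is the triangle inequality at [i = n - t] and
     [j = n - v.+1]. *)
  have in1 : n - t < n.+1 by lia.
  have jn1 : n - v.+1 < n.+1 by lia.
  have ji : (1 <= n - v.+1) && (n - v.+1 < n - t <= n - 1) by lia.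
  have /forallP/(_ (Ordinal jn1))/implyP/(_ ji) /= := ineq (Ordinal in1).
  rewrite (@triangle_sum n b (n - t) (n - v.+1) (n - (n - v.+1))) //; try lia.
  rewrite (@triangle_sum n b (n - t) (n - v.+1).+1 (n - (n - v.+1) - 1)) //; try lia.
  have -> : n - (n - t) = t by lia.
  have -> : n - (n - v.+1) = v.+1 by lia.
  by rewrite subn1.
case=> bs bf; apply/andP; split.
  by apply/forallP=> i; apply/forallP=> j; apply/implyP=> /bs.
apply/forallP=> i; apply/forallP=> j; apply/implyP=> /and3P[j1 ji ilen].
rewrite (@triangle_sum n b i j (n - j)) //; try lia.
rewrite (@triangle_sum n b i j.+1 (n - j - 1)) //; try lia.
have -> : n - j - 1 = n - j.+1 by lia.
have -> : n - j = (n - j.+1).+1 by lia.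
by apply: bf; lia.
Qed.

(** * The bijection between TSSCPPs and boolean triangles *)

Lemma compl_cross_triangle_of (n : nat) (T : {set box n}) (d s : nat) :
  is_TSSCPP T ->
  compl_cross n (cross_at (triangle_of T)) d s = row_set n (layers T) d s.
Proof.
move=> tT; have sP := layers_staircase tT.
rewrite /compl_cross /cross_at.
case: (posnP s) => [->|s0] /=; first by rewrite /row_set.
case: (leqP s d) => sd /=; last first.
  apply/esym/negP=> /andP[_ /existsP[a /andP[]]].
  by rewrite (stair_sym sP) => /(stair_bound sP); lia.
case: (ltnP d n) => dn /=; last first.
  by apply/esym/negP=> /andP[_ /existsP[a /andP[/(stair_height sP)]]]; lia.
rewrite triangle_ofE // !inordK; [|lia|lia].
have -> : n - (n - s) = s by lia.
have -> : 0 < n - s <= n - 1 by lia.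
have -> : s <= d <= n - 1 by lia.
by rewrite negbK.
Qed.

(** By [row_count], the nesting of layers turns into inequalities between tail counts, hence into
    the ballot condition. *)
Lemma triangle_of_boolean (n : nat) (T : {set box n}) :
  is_TSSCPP T -> is_boolean_triangle (triangle_of T).
Proof.
move=> tT; have sP := layers_staircase tT.
apply/is_boolean_triangleP; split.
  by move=> i j; rewrite triangle_ofE // => /and3P[-> -> _].
apply/ballot_tail; first exact: cross_at_le.
move=> d d' t t1 dd' dn.
have tcE d0 : tail_count n (compl_cross n (cross_at (triangle_of T))) d0 t
            = tail_count n (row_set n (layers T)) d0 t.
  by apply: eq_bigr => s _; rewrite compl_cross_triangle_of.
rewrite !tcE; case E: (tail_count _ _ d t) => [|c] //.
have : c < tail_count n (row_set n (layers T)) d t by rewrite E.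
rewrite !row_count // => H.
exact: (stair_mono sP H).
Qed.

(** The triangle gives the row sets, these give the layers, and the layers give the whole
    partition. *)
Lemma triangle_of_inj (n : nat) (T1 T2 : {set box n}) :
  is_TSSCPP T1 -> is_TSSCPP T2 -> triangle_of T1 = triangle_of T2 -> T1 = T2.
Proof.
move=> tT1 tT2 eT.
have Leq d a e : layers T1 d a e = layers T2 d a e.
  rewrite -(shape_of_row_set _ _ _ (layers_staircase tT1)).
  rewrite -(shape_of_row_set _ _ _ (layers_staircase tT2)).
  rewrite /shape_of; congr (_ && (_ < _)); apply: eq_bigr => s _.
  by rewrite -!compl_cross_triangle_of // eT.
apply/setP=> -[[x y] z]; rewrite -!mem_boxE !mem_box_assemble //.
by rewrite /assemble !Leq.
Qed.

Lemma triangle_of_surj (n : nat) (b : 'M[bool]_n.+1) : is_boolean_triangle b ->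
  exists2 T : {set box n}, is_TSSCPP T & triangle_of T = b.
Proof.
case/is_boolean_triangleP=> bs bf.
have cle := @cross_at_le n b.
have sP := shape_of_staircase cle bf.
exists (box_of n (shape_of n (compl_cross n (cross_at b)))).
  exact: box_of_TSSCPP.
apply/matrixP=> i j; rewrite triangle_ofE; last exact: box_of_TSSCPP.
have -> s : row_set n (layers (box_of n (shape_of n (compl_cross n (cross_at b))))) j s
          = compl_cross n (cross_at b) j s.
  rewrite -row_set_shape_of //; rewrite /row_set; congr (_ && _).
  by apply: eq_existsb => a; rewrite !layers_box_of.
case E: (1 <= i <= n - 1); last first.
  by apply/esym/negP=> /bs; rewrite E.
case E2: (n - i <= j <= n - 1); last first.
  by apply/esym/negP=> /bs; rewrite E2 andbF.
rewrite /= /compl_cross /cross_at.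
have -> : n - (n - i) = i by have := ltn_ord i; lia.
rewrite !inord_val.
have -> : (0 < n - i) by lia.
have -> : n - i <= j by lia.
have -> : j < n by lia.
by rewrite /= negbK.
Qed.

(** * Pipe dreams *)

(** Each word is increasing, so the ends of words are the critical prefixes. [A] and [B] accumulate
    the counts of words already read. *)
Lemma flatten_prefix_leq (ws : seq (seq nat)) (v A B : nat) :
  all (sorted ltn) ws ->
  (forall k, A + count_mem v.+1 (take k (flatten ws))
             <= B + count_mem v (take k (flatten ws))) <->
  (forall m, A + count_mem v.+1 (flatten (take m ws))
             <= B + count_mem v (flatten (take m ws))).
Proof.
move=> ws_sorted; split=> [H m|].
  have := H (size (flatten (take m ws))).
  have -> : flatten ws = flatten (take m ws) ++ flatten (drop m ws).
    by rewrite -flatten_cat cat_take_drop.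
  by rewrite take_size_cat.
elim: ws A B ws_sorted => [|w ws IH] A B //= /andP[sw sws] H k.
rewrite take_cat; case: ltnP => kw; last first.
  rewrite !count_cat !addnA; apply: IH => // m.
  by have := H m.+1; rewrite /= !count_cat !addnA.
have H0 := H 0; have H1 := H 1; rewrite /= take0 /= cats0 in H0 H1.
rewrite !addn0 in H0.
rewrite -(cat_take_drop k w) !count_cat in H1.
(* If [v.+1] has been read, no [v] remains in [w] and the end of [w] decides; otherwise its
   beginning does. *)
case: (boolP (v.+1 \in take k w)) => vk; last by rewrite (count_memPn vk); lia.
have vd : v \notin drop k w.
  apply/negP=> vd; move: sw; rewrite -(cat_take_drop k w).
  rewrite (sorted_pairwise ltn_trans) pairwise_cat => /andP[/allrelP/(_ _ _ vk vd)].
  by rewrite ltnNge leqnSn.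
rewrite (count_memPn vd) in H1; lia.
Qed.

Definition row_word (n : nat) (D : 'M[bool]_n.+1) (r : nat) : seq nat :=
  [seq (r + c - 1) | c <- iota 1 n & D (inord r) (inord c)].

(** Letter [v] in row [r] comes from column [v.+1 - r]. *)
Definition dream_cross (n : nat) (D : 'M[bool]_n.+1) (r v : nat) : bool :=
  [&& 1 <= r, r <= v, v < n & D (inord r) (inord (v.+1 - r))].

Lemma row_word_sorted (n : nat) (D : 'M[bool]_n.+1) (r : nat) :
  1 <= r -> sorted ltn (row_word D r).
Proof.
move=> r1; apply: (homo_sorted (e := ltn)); first by move=> x y /=; lia.
by apply: sorted_filter; [exact: ltn_trans|exact: iota_ltn_sorted].
Qed.

Lemma count_row_word (n : nat) (D : 'M[bool]_n.+1) (r v : nat) :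
  is_pipe_dream D -> 1 <= r <= n -> count_mem v (row_word D r) = dream_cross D r v.
Proof.
move=> /forallP pD /andP[r1 rn].
have uw : uniq (row_word D r).
  exact: sorted_uniq ltn_trans ltnn _ (row_word_sorted D r1).
rewrite count_uniq_mem //; congr nat_of_bool.
apply/mapP/idP=> [[c]|/and4P[_ rv vn Dv]].
  rewrite mem_filter mem_iota => /andP[Dc cn] ->.
  have /forallP/(_ (inord c))/implyP/(_ Dc) := pD (inord r).
  rewrite !inordK; [|lia|lia] => /and3P[_ _ rc].
  rewrite /dream_cross; have -> : (r + c - 1).+1 - r = c by lia.
  by rewrite Dc andbT; lia.
exists (v.+1 - r); last lia.
by rewrite mem_filter Dv mem_iota; lia.
Qed.

Lemma count_bottom_rows (n : nat) (D : 'M[bool]_n.+1) (m v : nat) :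
  is_pipe_dream D -> m <= n ->
  count_mem v (flatten (take m [seq row_word D r | r <- rev (iota 1 n)]))
  = \sum_(n.+1 - m <= r < n.+1) dream_cross D r v.
Proof.
move=> pD mn; rewrite -map_take take_rev size_iota drop_iota.
rewrite count_flatten -map_comp map_rev sumn_rev sumnE big_map.
have -> : iota (1 + (n - m)) (n - (n - m)) = index_iota (n.+1 - m) n.+1.
  by rewrite /index_iota; congr iota; lia.
by apply: eq_big_nat => r rmn /=; rewrite count_row_word //; lia.
Qed.

Lemma pseudo_YamanouchiP (n : nat) (D : 'M[bool]_n.+1) :
  is_pipe_dream D -> pseudo_Yamanouchi D <-> ballot n (dream_cross D).
Proof.
move=> pD; set ws := [seq row_word D r | r <- rev (iota 1 n)].
have ws_sorted : all (sorted ltn) ws.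
  apply/allP=> w /mapP[r]; rewrite mem_rev mem_iota => /andP[r1 _] ->.
  exact: row_word_sorted.
have -> : pseudo_Yamanouchi D <-> forall v, 1 <= v -> v.+1 < n -> forall k,
    0 + count_mem v.+1 (take k (flatten ws)) <= 1 + count_mem v (take k (flatten ws)).
  split=> [/allP H v v1 vn k|H].
    have Hk k0 : 1 <= k0 <= size (flatten ws) ->
        count_mem v.+1 (take k0 (flatten ws)) <= 1 + count_mem v (take k0 (flatten ws)).
      move=> k0s; have /H/allP/(_ v) : k0 \in iota 1 (size (flatten ws)).
        by rewrite mem_iota; lia.
      by apply; rewrite mem_iota; lia.
    case: (posnP k) => [->|k0]; first by rewrite take0.
    case: (leqP k (size (flatten ws))) => ks; first by apply: Hk; lia.
    rewrite take_oversize; last exact: ltnW.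
    case: (posnP (size (flatten ws))) => [/size0nil->//|s0].
    by rewrite -[flatten ws]take_size; apply: Hk; lia.
  apply/allP=> k _; apply/allP=> v; rewrite mem_iota => vn.
  by apply: H; lia.
split=> H.
  (* Rows are read from the bottom, so rows [t] to [n] are the first [n.+1 - t] words. *)
  move=> v t tv vn; have := (flatten_prefix_leq v 0 1 ws_sorted).1 (H v _ vn) (n.+1 - t).
  rewrite !count_bottom_rows //; try lia.
  have -> : n.+1 - (n.+1 - t) = t by lia.
  by apply; lia.
move=> v v1 vn; apply/(flatten_prefix_leq v 0 1 ws_sorted) => m.
have small m0 : m0 <= n -> 0 + count_mem v.+1 (flatten (take m0 ws))
                           <= 1 + count_mem v (flatten (take m0 ws)).
  move=> mn; rewrite !count_bottom_rows //; apply: ballot_all => //; last lia.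
  by move=> r u /and4P[].
case: (leqP m n) => mn; first exact: small.
have sws : size ws = n by rewrite size_map size_rev size_iota.
rewrite take_oversize ?sws; last exact: ltnW.
by rewrite -[ws]take_size sws; apply: small.
Qed.

(** * The bijection between boolean triangles and pipe dreams *)

Definition dream_of (n : nat) (b : 'M[bool]_n.+1) : 'M[bool]_n.+1 :=
  \matrix_(r < n.+1, c < n.+1)
    [&& 1 <= r, 1 <= c, r + c < n + 1 & b (inord (n - r)) (inord (r + c - 1))].

(** The column [i + j + 1 - n] is the one that gives letter [j] in row [n - i]. *)
Definition triangle_of_dream (n : nat) (D : 'M[bool]_n.+1) : 'M[bool]_n.+1 :=
  \matrix_(i < n.+1, j < n.+1)
    [&& 1 <= i <= n - 1, n - i <= j <= n - 1 &
        D (inord (n - i)) (inord (i + j + 1 - n))].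

Lemma ballot_ext (n : nat) (f g : nat -> nat -> bool) :
  f =2 g -> ballot n f -> ballot n g.
Proof.
move=> fg bf v t tv vn.
have E u : \sum_(t <= r < n.+1) g r u = \sum_(t <= r < n.+1) f r u.
  by apply: eq_bigr => r _; rewrite fg.
by rewrite !E; apply: bf.
Qed.

Lemma dream_cross_dream_of (n : nat) (b : 'M[bool]_n.+1) :
  dream_cross (dream_of b) =2 cross_at b.
Proof.
move=> r v; rewrite /dream_cross /cross_at.
case: (boolP (1 <= r)) => //= r1; case: (leqP r v) => //= rv.
case: (ltnP v n) => //= vn; rewrite mxE !inordK; [|lia|lia].
have -> : r + (v.+1 - r) = v.+1 by lia.
have -> : 0 < v.+1 - r by lia.
by rewrite r1 subn1 addn1 ltnS vn.
Qed.

Lemma dream_of_pipe_dream (n : nat) (b : 'M[bool]_n.+1) : is_pipe_dream (dream_of b).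
Proof.
apply/forallP=> r; apply/forallP=> c; apply/implyP; rewrite mxE.
by case/and4P=> -> -> ->.
Qed.

Lemma dream_of_PY (n : nat) (b : 'M[bool]_n.+1) : is_boolean_triangle b ->
  is_pipe_dream (dream_of b) && pseudo_Yamanouchi (dream_of b).
Proof.
move=> /is_boolean_triangleP[bs bf]; have pD := dream_of_pipe_dream b.
rewrite pD; apply/pseudo_YamanouchiP => //.
by apply: ballot_ext bf => r v; rewrite dream_cross_dream_of.
Qed.

Lemma triangle_of_dreamK (n : nat) (D : 'M[bool]_n.+1) :
  is_pipe_dream D -> dream_of (triangle_of_dream D) = D.
Proof.
move=> /forallP pD; apply/matrixP=> r c; rewrite mxE.
case: (boolP [&& 1 <= r, 1 <= c & r + c < n + 1]) => [/and3P[r1 c1 rc]|out]; last first.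
  have -> : D r c = false.
    by apply: contraNF out; have /forallP/(_ c)/implyP := pD r.
  by apply: contraNF out => /and4P[-> -> ->].
rewrite r1 c1 rc mxE !inordK; [|lia|lia].
have -> : n - (n - r) = r by lia.
have -> : n - r + (r + c - 1) + 1 - n = c by lia.
rewrite !inord_val /=.
have -> : 0 < n - r <= n - 1 by lia.
by have -> : r <= r + c - 1 <= n - 1 by lia.
Qed.

Lemma dream_ofK (n : nat) (b : 'M[bool]_n.+1) :
  is_boolean_triangle b -> triangle_of_dream (dream_of b) = b.
Proof.
move=> /is_boolean_triangleP[bs _]; apply/matrixP=> i j; rewrite mxE.
case: (boolP ((1 <= i <= n - 1) && (n - i <= j <= n - 1))) => [/andP[ir jr]|out];
  last first.
  have -> : b i j = false by apply: contraNF out => /bs.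
  by apply: contraNF out => /and3P[-> ->].
rewrite ir jr mxE !inordK; [|lia|lia].
have -> : n - (n - i) = i by lia.
have -> : n - i + (i + j + 1 - n) - 1 = j by lia.
rewrite !inord_val /=.
have -> : 0 < n - i by lia.
have -> : 0 < i + j + 1 - n by lia.
by have -> : n - i + (i + j + 1 - n) < n + 1 by lia.
Qed.

Lemma triangle_of_dream_boolean (n : nat) (D : 'M[bool]_n.+1) :
  is_pipe_dream D -> pseudo_Yamanouchi D -> is_boolean_triangle (triangle_of_dream D).
Proof.
move=> pD /(pseudo_YamanouchiP pD) bf; apply/is_boolean_triangleP; split.
  by move=> i j; rewrite mxE => /and3P[-> ->].
by apply: ballot_ext bf => r v; rewrite -dream_cross_dream_of triangle_of_dreamK.
Qed.

Lemma dream_of_weight (n : nat) (b : 'M[bool]_n.+1) : is_boolean_triangle b ->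
  pipe_dream_weight (dream_of b) = triangle_weight b.
Proof.
move=> tb; have [bs _] := (is_boolean_triangleP b).1 tb.
(* Here [rev_ord] sends [i] to [n - i], matching row [n - i] of the dream with row [i] of the
   triangle. *)
rewrite /pipe_dream_weight /triangle_weight (reindex_inj rev_ord_inj) /=.
apply: eq_bigr => i _; rewrite subSS.
rewrite (reindex_onto (fun j : 'I_n.+1 => inord (i + j + 1 - n))
                      (fun c : 'I_n.+1 => inord (n - i + c - 1))) /=.
  apply: eq_bigl => j; rewrite mxE /= subSS.
  have -> : n - (n - i) = i by have := ltn_ord i; lia.
  rewrite inord_val; apply/andP/idP=> [[/and4P[_ _ _ bij] /eqP jE]|bij].
    by rewrite jE in bij.
  have /andP[ir jr] := bs _ _ bij.
  rewrite inordK; last lia.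
  have -> : n - i + (i + j + 1 - n) - 1 = j by lia.
  rewrite inord_val bij eqxx andbT; split=> //; lia.
move=> c; rewrite mxE /= subSS => /and4P[ni c1 nic _]; apply: val_inj => /=.
by rewrite !inordK; lia.
Qed.

(** * Composition of the two bijections *)

Local Open Scope ring_scope.

Theorem theorem3p3 (n : nat) (hn : (1 <= n)%N) :
  exists tri : TSSCPP n -> boolean_triangle n,
    [/\ bijective tri,
        forall T : TSSCPP n, val (tri T) = triangle_of (val T)
      & exists phi : TSSCPP n -> PY_pipe_dream n,
          bijective phi /\
          forall T : TSSCPP n,
            pipe_dream_weight (val (phi T)) = triangle_weight (val (tri T))].
Proof.
pose tri (T : TSSCPP n) : boolean_triangle n :=
  exist _ (triangle_of (val T)) (triangle_of_boolean (valP T)).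
pose dream (b : boolean_triangle n) : PY_pipe_dream n :=
  exist _ (dream_of (val b)) (dream_of_PY (valP b)).
have tri_bij : bijective tri.
  apply: surj_inj_bij => [T1 T2 /(congr1 val) /= eT|[b tb]].
    by apply: val_inj; apply: triangle_of_inj eT; exact: valP.
  have [T tT eT] := triangle_of_surj tb.
  by exists (exist _ T tT); apply: val_inj.
have dream_bij : bijective dream.
  have unD (D : PY_pipe_dream n) : is_boolean_triangle (triangle_of_dream (val D)).
    by have /andP[] := valP D; apply: triangle_of_dream_boolean.
  exists (fun D => exist _ (triangle_of_dream (val D)) (unD D)) => [b|D]; apply: val_inj.
    by apply: dream_ofK; exact: valP.
  by apply: triangle_of_dreamK; have /andP[] := valP D.
exists tri; split=> //; exists (dream \o tri); split; first exact: bij_comp.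
by move=> T /=; apply: dream_of_weight; apply: triangle_of_boolean; exact: valP.
Qed.
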